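(* Let $G$ be a finite simple König–Egerváry graph with $n$ vertices. Then the following are equivalent: (i) $\alpha(G)=n/2$; (ii) $G$ has a perfect matching; (iii) $G$ is quasi-regularizable; (iv) $|core(G)|\leq|N(core(G))|$.
   Context: $\alpha(G)$ is the maximum size of a stable set, $\mu(G)$ the maximum size of a matching; $G$ is König–Egerváry if $\alpha(G)+\mu(G)=|V(G)|$. $\Omega(G)$ is the set of maximum stable sets, $core(G)=\bigcap\{S:S\in\Omega(G)\}$, and for $A\subseteq V(G)$, $N(A)$ is the set of vertices adjacent to some vertex of $A$. $G$ is quasi-regularizable if one can replace each edge of $G$ by a non-negative integer number of parallel copies so as to obtain a regular multigraph of nonzero degree. *)

(* Defs.v *)
From mathcomp Require Import all_boot.

Set Implicit Arguments.
Unset Strict Implicit.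
Unset Printing Implicit Defensive.

(* A finite simple graph is given by a vertex set [T : finType] and an
   adjacency relation [e : rel T] assumed symmetric and irreflexive. *)
Section SimpleGraph.

Variables (T : finType) (e : rel T).
Implicit Types (A S : {set T}) (M : {set {set T}}) (v : T).

Definition edges : {set {set T}} :=
  [set [set xy.1; xy.2] | xy : T * T & e xy.1 xy.2].

Definition stable S : bool := [forall x in S, forall y in S, ~~ e x y].

Definition alpha : nat := \max_(S : {set T} | stable S) #|S|.

Definition matching M : bool := (M \subset edges) && trivIset M.

Definition mu : nat := \max_(M : {set {set T}} | matching M) #|M|.

Definition perfect_matching M : bool := matching M && (cover M == [set: T]).

Definition konig_egervary : Prop := alpha + mu = #|T|.

Definition max_stable_sets : {set {set T}} :=
  [set S : {set T} | stable S && (#|S| == alpha)].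

Definition core : {set T} := \bigcap_(S in max_stable_sets) S.

Definition neighborhood A : {set T} := [set v | [exists u in A, e u v]].

(* Degree of [v] in the multigraph in which each edge [a] has been replaced by
   [w a] parallel copies; values of [w] outside [edges] are irrelevant. *)
Definition multi_degree (w : {set T} -> nat) v : nat :=
  \sum_(a in edges | v \in a) w a.

Definition quasi_regularizable : Prop :=
  exists (w : {set T} -> nat) (d : nat),
    0 < d /\ forall v, multi_degree w v = d.

End SimpleGraph.

(* Main.v *)
(* In a König–Egerváry graph a maximum matching M has as many edges as the
   complement of a maximum stable set S has vertices, and every edge meets that
   complement.  Hence M covers the complement of every such S, with exactly one
   vertex of each edge outside S.  So the vertices missed by M lie in the core,
   and M pairs N(core) with part of the core: |core| exceeds |N(core)| by at
   least the number of vertices missed by M. *)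
Require Import Defs.
From mathcomp Require Import all_boot all_order all_algebra.

Import GRing.Theory Num.Theory.
Local Open Scope ring_scope.

Section Graph.

Local Open Scope nat_scope.

Variables (T : finType) (e : rel T).
Hypotheses (e_sym : symmetric e) (e_irr : irreflexive e).
Implicit Types (A B S a : {set T}) (M : {set {set T}}).

Lemma edgesP a :
  reflect (exists x y, [/\ e x y, x != y & a = [set x; y]]) (a \in edges e).
Proof.
apply: (iffP imsetP) => [[[x y]]|[x [y [exy _ ->]]]].
  rewrite inE /= => exy ->; exists x, y; split=> //; apply: contraTN exy => /eqP->.
  by rewrite e_irr.
by exists (x, y); rewrite ?inE.
Qed.

(** The edgewise step of two counting arguments: an edge that has a partner in [B] for each end in
    [A] meets [B] at least as often as [A]. *)
Lemma card_setI_pair x y A B : x != y ->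
    (x \in A -> y \in B) -> (y \in A -> x \in B) ->
  #|[set x; y] :&: A| <= #|[set x; y] :&: B|.
Proof.
move=> nxy xAB yAB.
have cardE C : #|[set x; y] :&: C| = (x \in C) + (y \in C).
  rewrite -sum1_card big_mkcond /= (bigD1 x) //= (bigD1 y) 1?eq_sym //= big1.
    by rewrite !inE !eqxx orbT /=; do 2!case: (_ \in C).
  by move=> z /andP[zx zy]; rewrite !inE (negPf zx) (negPf zy).
rewrite !cardE addnC; apply: leq_add.
  by case: (y \in A) yAB => // ->.
by case: (x \in A) xAB => // ->.
Qed.

Lemma card_coverI M A : trivIset M ->
  #|cover M :&: A| = \sum_(a in M) #|a :&: A|.
Proof.
move=> tM; rewrite -sum1_card.
under eq_bigl do rewrite inE.
rewrite big_trivIset_cond //; apply: eq_bigr => a _.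
by rewrite -sum1_card; apply: eq_bigl => x; rewrite inE.
Qed.

Lemma card_edge a : a \in edges e -> #|a| = 2.
Proof. by case/edgesP=> x [y [_ nxy ->]]; rewrite cards2 nxy. Qed.

Lemma card_cover_matching M : matching e M -> #|cover M| = #|M| * 2.
Proof.
case/andP=> /subsetP sM /eqP <-; rewrite -sum_nat_const.
by apply: eq_bigr => a /sM /card_edge.
Qed.

Lemma exists_max_matching : exists2 M, matching e M & #|M| = mu e.
Proof.
have m0 : matching e set0.
  by rewrite /matching sub0set /trivIset /cover !big_set0 cards0.
rewrite /mu (bigmax_eq_arg set0) //.
by case: arg_maxnP => // M mM _; exists M.
Qed.

Lemma exists_max_stable_set : exists S, S \in max_stable_sets e.
Proof.
have s0 : stable e set0 by apply/forall_inP => x; rewrite inE.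
rewrite /max_stable_sets /alpha (bigmax_eq_arg set0) //.
by case: arg_maxnP => // S sS _; exists S; rewrite inE sS eqxx.
Qed.

Lemma neighborhood_core_notin S x :
  S \in max_stable_sets e -> x \in neighborhood e (core e) -> x \notin S.
Proof.
move=> maxS; rewrite inE => /existsP[u /andP[/bigcapP/(_ S maxS) uS eux]].
apply: contraL eux => xS; move: maxS; rewrite inE => /andP[/forall_inP stS _].
by move/forall_inP: (stS u uS); apply.
Qed.

Lemma card_le_neighborhood A :
  quasi_regularizable e -> #|A| <= #|neighborhood e A|.
Proof.
case=> w [d [d_gt0 wd]].
(* Double counting of weighted incidences: an edge [a] contributes [w a] at each of its ends in
   [B]. *)
have sumE B : #|B| * d = \sum_(a in edges e) #|a :&: B| * w a.
  rewrite -sum_nat_const -(eq_bigr _ (fun v _ => wd v)) /multi_degree.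
  rewrite (exchange_big_dep (mem (edges e))) /=; last by move=> ? ? _ /andP[].
  apply: eq_bigr => a aE; rewrite -sum_nat_const; apply: eq_bigl => v.
  by rewrite inE aE andbC.
rewrite -(leq_pmul2r d_gt0) !sumE; apply: leq_sum => a /edgesP[x [y [exy nxy ->]]].
rewrite leq_mul2r; apply/orP; right; apply: card_setI_pair => // zA; rewrite inE.
  by apply/existsP; exists x; rewrite zA.
by apply/existsP; exists y; rewrite zA e_sym.
Qed.

Lemma perfect_matching_quasi_regularizable M :
  perfect_matching e M -> quasi_regularizable e.
Proof.
case/andP=> /andP[/subsetP sM tM] /eqP cM.
(* Keeping one copy of each edge of [M] and none of the others gives degree 1: only [pblock M v]
   counts at [v]. *)
exists (fun a => a \in M), 1; split=> // v; rewrite /multi_degree.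
have vM : v \in cover M by rewrite cM inE.
rewrite (bigD1 (pblock M v)) /=; last by rewrite sM ?mem_pblock // pblock_mem.
rewrite pblock_mem // big1 // => a /andP[/andP[_ va] na].
case aM: (a \in M) => //; by rewrite (def_pblock tM aM va) eqxx in na.
Qed.

Section KonigEgervary.

Hypothesis KE : konig_egervary e.

Variable M : {set {set T}}.
Hypotheses (matM : matching e M) (maxM : #|M| = mu e).

(** Stability of [S] and disjointness of the edges give [#|M| <= #|cover M :&: ~: S| <= #|~: S|].
    The outer terms agree by [KE], so equality holds throughout. *)
Lemma max_matching_setC S : S \in max_stable_sets e ->
  ~: S \subset cover M /\ {in M, forall a, #|a :&: ~: S| = 1}.
Proof.
rewrite inE => /andP[/forall_inP stS /eqP cS].
have [/subsetP sM tM] := andP matM.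
have cSC : #|~: S| = #|M| by apply/eqP; rewrite -(eqn_add2l #|S|) cardsC cS maxM KE.
(* The equality case is carried along, so that equality of the sums over [M] forces each term to be
   1. *)
have meet a : a \in M -> 1 <= #|a :&: ~: S| ?= iff (#|a :&: ~: S| == 1).
  move=> /sM/edgesP[x [y [exy _ ->]]]; split; last by rewrite eq_sym.
  rewrite card_gt0; apply/set0Pn; have [xS|xS] := boolP (x \in S); last first.
    by exists x; rewrite !inE eqxx.
  exists y; rewrite !inE eqxx orbT /=; apply: contraL exy => yS.
  by move/forall_inP: (stS x xS); apply.
have [le_sum eq_sum] := leqif_sum meet.
rewrite -card_coverI // sum1_card in le_sum eq_sum.
have le_setC : #|cover M :&: ~: S| <= #|~: S| by rewrite subset_leq_card ?subsetIr.
have eq_card : #|M| = #|cover M :&: ~: S|.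
  by apply/eqP; rewrite eqn_leq le_sum -cSC.
split; last first.
  move: eq_sum; rewrite eq_card eqxx => /esym/forall_inP h a aM.
  exact/eqP/h.
apply/setIidPr/eqP; rewrite eqEcard subsetIr /=.
by rewrite -eq_card cSC.
Qed.

Lemma max_matching_perfect :
  #|core e| <= #|neighborhood e (core e)| -> perfect_matching e M.
Proof.
move=> le_core; rewrite /perfect_matching matM /=.
have [/subsetP sM tM] := andP matM.
(* Each maximum stable set [S] misses [x], and the edge has only one end outside [S], so [y] is in
   [S]. *)
have mate x y : [set x; y] \in M ->
    x != y -> x \in neighborhood e (core e) -> y \in core e.
  move=> xyM nxy xN; apply/bigcapP=> S maxS.
  have [_ /(_ _ xyM) c1] := max_matching_setC S maxS.
  apply: contra_eqT c1 => yS; rewrite (setIidPl _) ?cards2 ?nxy //.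
  by rewrite subUset !sub1set !in_setC yS (neighborhood_core_notin S).
have unmatched : ~: cover M \subset core e.
  apply/bigcapsP => S /max_matching_setC[sSM _].
  by rewrite -[S]setCK setCS.
have N_matched : neighborhood e (core e) \subset cover M.
  have [S maxS] := exists_max_stable_set.
  apply/subsetP=> x xN; have [/subsetP-> //] := max_matching_setC S maxS.
  by rewrite inE (neighborhood_core_notin S).
have : #|neighborhood e (core e)| <= #|cover M :&: core e|.
  rewrite -(setIidPr N_matched) !card_coverI //; apply: leq_sum => a aM.
  have /edgesP[x [y [_ nxy aE]]] := sM a aM; rewrite aE in aM *.
  apply: card_setI_pair => //; first exact: mate.
  by apply: mate; rewrite 1?setUC 1?eq_sym.
(* Now [M] covers as many vertices of the core as there are, hence all of it; but every uncovered
   vertex lies in the core, so there is none. *)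
move=> /(leq_trans le_core) le_coreM.
have core_matched : core e \subset cover M.
  by apply/setIidPr/eqP; rewrite eqEcard subsetIr.
rewrite -subTset; apply/subsetP=> x _.
apply: contraT => xM; case/negP: (xM).
by apply: (subsetP (subset_trans unmatched core_matched)); rewrite inE.
Qed.

(** Since [#|cover M|] is twice [mu e] and [#|T|] is [alpha e + mu e], perfection means
    [alpha e <= mu e]; the reverse inequality always holds because [cover M] fits into [T]. *)
Lemma perfect_max_matching : perfect_matching e M = (alpha e * 2 == #|T|).
Proof.
rewrite /perfect_matching matM /= eqEcard subsetT /= cardsT.
rewrite card_cover_matching // maxM -KE !muln2 -!addnn eqn_add2l.
rewrite leq_add2r eqn_leq.
suff -> : mu e <= alpha e by rewrite andbT.
have := max_card (mem (cover M)).
by rewrite card_cover_matching // maxM -KE muln2 -addnn leq_add2r.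
Qed.

End KonigEgervary.

End Graph.

Theorem theorem7 (T : finType) (e : rel T) (n : nat)
    (e_sym : symmetric e) (e_irr : irreflexive e)
    (card_T : #|T| = n) (KE : konig_egervary e) :
  [<-> (alpha e)%:R = n%:R / 2%:R :> rat;
       exists M : {set {set T}}, perfect_matching e M;
       quasi_regularizable e;
       (#|core e| <= #|neighborhood e (core e)|)%N].
Proof.
have [M matM maxM] := exists_max_matching T e.
have perfectE := perfect_max_matching T e e_irr KE M matM maxM.
tfae.
- move=> half; exists M; rewrite perfectE card_T -(eqr_nat rat) natrM half.
  by rewrite divfK.
- by case=> M' /perfect_matching_quasi_regularizable.
- exact: card_le_neighborhood.
(* The cycle closes through the perfection of the fixed maximum matching [M]. *)
- move=> /(max_matching_perfect _ _ e_irr KE _ matM maxM).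
  rewrite perfectE card_T => /eqP <-.
  by rewrite natrM mulfK.
Qed.
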